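(* Let $F$ be an $\epsilon_h$-soft $\mathrm{UPE}(D{:}R|Z;E,\mathcal{H})$, where $D$ is a bit string of length $n$, and let $p,\delta>0$ with $p\delta\ge 1/2^n$. Write $\sigma_h=-\log_2(p)$ and suppose that $\mathcal{E}$ is a strong extractor such that $(n,l,\sigma_h,\sigma,\epsilon_x)$ satisfies the extractor constraints. Let $S$ be a length-$l$ uniform seed string independent of all other RVs, and abbreviate $\mathcal{E}=\mathcal{E}(D,S;\sigma_h,\sigma,\epsilon_x)$. Then for every $\mu\in\mathcal{H}$ with $\kappa=\mathbb{P}_\mu(F\le p\delta)>0$, $$\mathrm{TV}\bigl(\mu[\mathcal{E}SZE\,|\,F\le p\delta],\ \mathrm{Unif}_{\mathcal{E}S}\otimes\mu[ZE|F\le p\delta]\bigr)\le \epsilon_x+(2\epsilon_h+\delta)/\kappa .$$ In particular, setting $\mathcal{P}_X=\mathcal{E}$, $\mathcal{P}_S=S$ and $\mathcal{P}_P=1$ if $F\le p\delta$, $\mathcal{P}_P=0$ otherwise, defines a randomness generation protocol that is $(\sigma,\epsilon_x+2\epsilon_h+\delta)$-sound with respect to $ZE$ and $\mathcal{H}$.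
   Context: All random variables (RVs) have finite value spaces; $\mathrm{Rng}(X)$ is the value space of $X$. Juxtaposition denotes joint RVs and values. $R,Z,E$ are RVs, $D$ is a function of $R$, and $\mathcal{H}$ is a set (model) of joint distributions of $R,Z,E$; each $\mu\in\mathcal{H}$ is extended to include the independent uniform seed $S$. $\mu[X|\phi]$ is the distribution of $X$ conditional on $\phi$; conditions involving conditional probabilities are only required for conditioning values of positive probability. $\mathrm{TV}(\nu,\nu')=\frac12\sum_x|\nu(x)-\nu'(x)|$; $\mathrm{Unif}_X$ is the uniform distribution on $\mathrm{Rng}(X)$ (so $\mathrm{Unif}_{\mathcal{E}S}$ is uniform on $\{0,1\}^\sigma\times\{0,1\}^l$). A subprobability distribution is a non-negative function $\tilde\nu$ with weight $w(\tilde\nu)=\sum_x\tilde\nu(x)\le 1$. Soft UPE: for $0\le\epsilon\le1$, a function $F:\mathrm{Rng}(RZ)\to[0,\infty)$ is an $\epsilon$-soft $\mathrm{UPE}(D{:}R|Z;E,\mathcal{H})$ if for all values $e$ of $E$ and all $\mu\in\mathcal{H}$: (1) there exist subprobability distributions $\tilde\mu_z\le\mu[DR|ze]$ of $DR$ with $\sum_z w(\tilde\mu_z)\mu(z|e)\ge 1-\epsilon$; (2) there exists a non-negative function $q(r|dz)$ with $\sum_r q(r|dz)=1$ for all $dz$, such that $\tilde\mu_z(dr)\le F(rz)\,q(r|dz)$ for all $d,r,z$. Strong extractor: a family of functions $\mathcal{E}(\cdot,\cdot;\sigma_h,\sigma,\epsilon_x):\{0,1\}^n\times\{0,1\}^l\to\{0,1\}^\sigma$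 together with a set of admissible parameter tuples $(n,l,\sigma_h,\sigma,\epsilon_x)$ (those that ''satisfy the extractor constraints''; these always include $\sigma_h\le n$, $1\le\sigma\le\sigma_h$, $0<\epsilon_x\le1$), such that for each admissible tuple, if $D$ is any $n$-bit RV with $\max_d\mathbb{P}(D=d)\le2^{-\sigma_h}$ and $S$ is a uniform $l$-bit string independent of $D$, then the joint distribution of $\mathcal{E}(D,S;\sigma_h,\sigma,\epsilon_x)S$ is within TV distance $\epsilon_x$ of uniform. (No security against side information is assumed beyond this.) Soundness: a protocol with outputs $\mathcal{P}_X$ (principal bit string), $\mathcal{P}_S$ (reusable random string), $\mathcal{P}_P\in\{0,1\}$ (success flag) is $(\sigma,\epsilon)$-sound with respect to $E'$ and $\mathcal{H}$ if for all $\mu\in\mathcal{H}$, $|\mathcal{P}_X|=\sigma$ and there is a distribution $\nu_{E'}$ of $E'$ such that $\mathrm{TV}(\mu[\mathcal{P}_X\mathcal{P}_SE'|\mathcal{P}_P=1],\mathrm{Unif}_{\mathcal{P}_X}\otimes\mu[\mathcal{P}_S]\otimes\nu_{E'})\,\mathbb{P}_\mu(\mathcal{P}_P=1)\le\epsilon$ (the left side is read as $0$ if $\mathbb{P}_\mu(\mathcal{P}_P=1)=0$). *)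

(* Defs.v *)
From mathcomp Require Import all_boot all_order all_algebra.
From mathcomp Require Import all_classical all_reals all_analysis.

Set Implicit Arguments.
Unset Strict Implicit.
Unset Printing Implicit Defensive.

Import Order.TTheory GRing.Theory Num.Theory.

Local Open Scope classical_set_scope.
Local Open Scope ring_scope.

Notation bits n := (n.-tuple bool).

Definition log2 (K : realType) (x : K) : K := ln x / ln 2.

Section FiniteProbability.
Variable K : realType.

Definition weight (T : finType) (f : T -> K) : K := \sum_x f x.

Definition is_distr (T : finType) (f : T -> K) : Prop :=
  (forall x, 0 <= f x) /\ weight f = 1.

Definition is_subdistr (T : finType) (f : T -> K) : Prop :=
  (forall x, 0 <= f x) /\ weight f <= 1.

Definition TV (T : finType) (f g : T -> K) : K :=
  2^-1 * \sum_x `|f x - g x|.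

Definition unif (T : finType) : T -> K := fun=> #|T|%:R^-1.

Definition prodd (T U : finType) (f : T -> K) (g : U -> K) : T * U -> K :=
  fun xy => f xy.1 * g xy.2.

Definition Pr (W : finType) (mu : W -> K) (phi : pred W) : K :=
  \sum_(w | phi w) mu w.

Definition law (W T : finType) (mu : W -> K) (X : W -> T) : T -> K :=
  fun x => Pr mu (fun w => X w == x).

(* mu[X | phi]; only meaningful when 0 < Pr mu phi (it is 0 otherwise). *)
Definition cond (W T : finType) (mu : W -> K) (X : W -> T) (phi : pred W) :
    T -> K :=
  fun x => Pr mu (fun w => (X w == x) && phi w) / Pr mu phi.

End FiniteProbability.

Arguments unif K T : clear implicits.

(* Sample points of the model are triples w = (r, z, e). *)
Definition soft_UPE (K : realType) (RT ZT ET DT : finType) (D : RT -> DT)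
    (H : set (RT * ZT * ET -> K)) (eps : K) (F : RT -> ZT -> K) : Prop :=
  [/\ 0 <= eps <= 1,
      forall r z, 0 <= F r z
    & forall (e : ET) (mu : RT * ZT * ET -> K), H mu ->
      let rvDR := fun w : RT * ZT * ET => (D w.1.1, w.1.1) in
      let rvZ := fun w : RT * ZT * ET => w.1.2 in
      let evE := fun w : RT * ZT * ET => w.2 == e in
      let evZE := fun z (w : RT * ZT * ET) => (rvZ w == z) && evE w in
      0 < Pr mu evE ->
      exists mut : ZT -> (DT * RT -> K),
        [/\ forall z, is_subdistr (mut z),
            forall z, 0 < Pr mu (evZE z) ->
              forall dr, mut z dr <= cond mu rvDR (evZE z) dr,
            \sum_z weight (mut z) * cond mu rvZ evE z >= 1 - eps
          & exists q : RT -> DT -> ZT -> K,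
            [/\ forall r d z, 0 <= q r d z,
                forall d z, \sum_r q r d z = 1
              & forall d r z, mut z (d, r) <= F r z * q r d z]]].

Section StrongExtractor.
Variable K : realType.

Definition extractor_family : Type :=
  forall (n l : nat) (sigma_h : K) (sigma : nat) (eps_x : K),
    bits n -> bits l -> bits sigma.

(* The set of tuples (n, l, sigma_h, sigma, eps_x) that satisfy the extractor
   constraints. *)
Definition extractor_constraints : Type :=
  nat -> nat -> K -> nat -> K -> Prop.

(* The n-bit random variable is given by its distribution P; its joint
   distribution with the independent uniform seed is prodd P (unif K (bits l)). *)
Definition strong_extractor (Ext : extractor_family)
    (adm : extractor_constraints) : Prop :=
  forall (n l : nat) (sigma_h : K) (sigma : nat) (eps_x : K),
    adm n l sigma_h sigma eps_x ->
    [/\ sigma_h <= n%:R, (1 <= sigma)%N, sigma%:R <= sigma_h,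
        0 < eps_x <= 1
      & forall P : bits n -> K, is_distr P ->
        \big[Num.max/0]_d P d <= 2 `^ (- sigma_h) ->
        TV (law (prodd P (unif K (bits l)))
              (fun ds => (Ext n l sigma_h sigma eps_x ds.1 ds.2, ds.2)))
           (unif K (bits sigma * bits l)%type) <= eps_x].

End StrongExtractor.

(* The product with Pr mu PP vanishes when Pr mu PP = 0, whatever the value of
   the (then meaningless) total variation distance. *)
Definition sound (K : realType) (W ET' : finType) (k l : nat)
    (PX : W -> bits k) (PS : W -> bits l) (PP : W -> bool)
    (E' : W -> ET') (H : set (W -> K)) (sigma : nat) (eps : K) : Prop :=
  forall mu, H mu ->
    k = sigma /\
    exists2 nu : ET' -> K, is_distr nu
      & TV (cond mu (fun w => (PX w, PS w, E' w)) PP)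
           (prodd (prodd (unif K (bits k)) (law mu PS)) nu) * Pr mu PP <= eps.

(* Extension of a distribution, resp. a model, by an independent uniform
   l-bit seed, which becomes the last component of the sample point. *)
Definition seeded (K : realType) (W : finType) (l : nat) (mu : W -> K) :
    W * bits l -> K :=
  prodd mu (unif K (bits l)).

Definition seeded_model (K : realType) (W : finType) (l : nat)
    (H : set (W -> K)) : set (W * bits l -> K) :=
  @seeded K W l @` H.

(* Main.v *)
(* For fixed (z, e), the part g(d) of the smoothed density lying in the event
   F <= p * delta is at most p * delta, since q(.|d,z) sums to 1. If
   P(F <= p * delta | ze) >= delta, conditioning on that event therefore yields
   density at most p, which is completed to a distribution of D with
   min-entropy at least sigma_h and costs, unnormalized, only the smoothing
   deficit; otherwise the trivial bound on TV costs at most delta. Averaging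
   over (z, e), the deficits add up to at most eps_h, so the factor 2 in the
   claimed bound is not tight. *)
Require Import Defs.
From mathcomp Require Import all_boot all_order all_algebra.
From mathcomp Require Import all_classical all_reals all_analysis.
From mathcomp Require Import ring lra.

Set Implicit Arguments.
Unset Strict Implicit.
Unset Printing Implicit Defensive.

Import Order.TTheory GRing.Theory Num.Theory.

Local Open Scope classical_set_scope.
Local Open Scope ring_scope.

(** * Total variation distance of functions on finite types *)

Section TotalVariation.
Variable K : realType.

Lemma TV_triangle (T : finType) (g f h : T -> K) : TV f h <= TV f g + TV g h.
Proof.
rewrite /TV -mulrDr ler_wpM2l ?invr_ge0 // -big_split ler_sum // => x _.
exact: ler_distD.
Qed.

Lemma TVZ (T : finType) (k : K) (f g : T -> K) : 0 <= k ->
  TV (fun x => k * f x) (fun x => k * g x) = k * TV f g.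
Proof.
move=> k0; rewrite /TV mulrCA; congr (_ * _); rewrite mulr_sumr.
by apply: eq_bigr => x _; rewrite -mulrBr normrM ger0_norm.
Qed.

(** Pointwise, [f - g] is the difference of the nonnegative excesses over [h]. The minorant 0 gives
    the trivial bound; for [f] and [g] of equal weight, the distance is at most the mass that [h]
    misses. *)
Lemma TV_common_minorant (T : finType) (h f g : T -> K) :
  (forall x, h x <= f x) -> (forall x, h x <= g x) ->
  TV f g <= 2^-1 * (weight f + weight g) - weight h.
Proof.
move=> hf hg.
have -> : 2^-1 * (weight f + weight g) - weight h =
    2^-1 * \sum_x ((f x - h x) + (g x - h x)).
  rewrite big_split /= !sumrB -/(weight f) -/(weight g) -/(weight h).
  by field.
rewrite ler_wpM2l ?invr_ge0 // ler_sum // => x _.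
rewrite (_ : f x - g x = (f x - h x) - (g x - h x)); last by ring.
by apply: le_trans (ler_normB _ _) _; rewrite !ger0_norm ?subr_ge0.
Qed.

(** Data processing: on each fibre of [X], the absolute value of a sum is at most the sum of the
    absolute values. *)
Lemma TV_law (W T : finType) (X : W -> T) (f g : W -> K) :
  TV (law f X) (law g X) <= TV f g.
Proof.
rewrite ler_wpM2l ?invr_ge0 //.
rewrite (partition_big X predT) //=; apply: ler_sum => x _.
by rewrite /law /Pr -sumrB ler_norm_sum.
Qed.

Lemma TV_prodd (T U : finType) (f g : T -> K) (c : U -> K) :
  is_distr c -> TV (prodd f c) (prodd g c) = TV f g.
Proof.
move=> [c0 c1]; congr (_ * _).
rewrite -(pair_big predT predT (fun x y => `|f x * c y - g x * c y|)) /=.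
apply: eq_bigr => x _; rewrite -[RHS]mulr1 -c1 mulr_sumr.
by apply: eq_bigr => y _; rewrite -mulrBl normrM (ger0_norm (c0 y)).
Qed.

(** Serves to split the distance according to the value of the side information, so that the
    extractor is applied with that value fixed. *)
Lemma TV_slices (T U : finType) (f g : T * U -> K) :
  TV f g = \sum_u TV (fun x => f (x, u)) (fun x => g (x, u)).
Proof.
rewrite /TV -mulr_sumr exchange_big pair_big /=; congr (_ * _).
by apply: eq_bigr => -[].
Qed.

End TotalVariation.

(** * Finite distributions, marginals and independent products *)

Section FiniteDistributions.
Variable K : realType.

Lemma unif_distr (T : finType) : (0 < #|T|)%N -> is_distr (unif K T).
Proof.
move=> T0; split=> [x|]; first by rewrite invr_ge0.
by rewrite /weight /unif sumr_const -[LHS]mulr_natr mulVf // pnatr_eq0 -lt0n.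
Qed.

Lemma weight_prodd (T U : finType) (f : T -> K) (c : U -> K) :
  weight (prodd f c) = weight f * weight c.
Proof.
rewrite /weight mulr_suml -(pair_big predT predT (fun x y => f x * c y)) /=.
by apply: eq_bigr => x _; rewrite mulr_sumr.
Qed.

Lemma weight_law (W T : finType) (mu : W -> K) (X : W -> T) :
  weight (law mu X) = weight mu.
Proof. by rewrite /weight [RHS](partition_big X predT). Qed.

Lemma Pr_ge0 (W : finType) (mu : W -> K) (phi : pred W) :
  (forall w, 0 <= mu w) -> 0 <= Pr mu phi.
Proof. by move=> mu0; apply: sumr_ge0. Qed.

Lemma Pr_sub (W : finType) (mu : W -> K) (phi psi : pred W) :
  (forall w, 0 <= mu w) -> subpred phi psi -> Pr mu phi <= Pr mu psi.
Proof.
move=> mu0 sub; rewrite /Pr [leLHS]big_mkcond [leRHS]big_mkcond /=.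
apply: ler_sum => w _; case: ifPn => [/sub ->//|_].
by case: ifP.
Qed.

Lemma Pr_partition (W T : finType) (mu : W -> K) (X : W -> T) (A : pred W) :
  \sum_x Pr mu (fun w => (X w == x) && A w) = Pr mu A.
Proof.
rewrite [RHS](partition_big X predT) //=.
by apply: eq_bigr => x _; apply: eq_bigl => w; rewrite andbC.
Qed.

Lemma cond_distr (W T : finType) (mu : W -> K) (X : W -> T) (A : pred W) :
  (forall w, 0 <= mu w) -> 0 < Pr mu A -> is_distr (cond mu X A).
Proof.
move=> mu0 A0; split=> [x|]; first by rewrite divr_ge0 ?Pr_ge0.
by rewrite /weight -mulr_suml Pr_partition divff ?gt_eqF.
Qed.

Lemma law_distr (W T : finType) (mu : W -> K) (X : W -> T) :
  is_distr mu -> is_distr (law mu X).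
Proof. by move=> [mu0 mu1]; split=> [x|]; rewrite ?weight_law ?Pr_ge0. Qed.

Lemma Pr_prodd_fst (W U : finType) (mu : W -> K) (c : U -> K) (A : pred W) :
  weight c = 1 -> Pr (prodd mu c) (fun w => A w.1) = Pr mu A.
Proof.
move=> c1; rewrite /Pr.
transitivity (\sum_(w | A w) \sum_u mu w * c u).
  by rewrite pair_big; apply: eq_big => [[w u]|[]] //=; rewrite andbT.
by apply: eq_bigr => w _; rewrite -mulr_sumr -/(weight c) c1 mulr1.
Qed.

Lemma Pr_prodd_snd (W U : finType) (mu : W -> K) (c : U -> K) (A : pred U) :
  weight mu = 1 -> Pr (prodd mu c) (fun w => A w.2) = Pr c A.
Proof.
move=> mu1; rewrite /Pr.
transitivity (\sum_w \sum_(u | A u) mu w * c u).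
  by rewrite pair_big; apply: eq_big => [[w u]|[]].
rewrite exchange_big; apply: eq_bigr => u _.
by rewrite -mulr_suml -/(weight mu) mu1 mul1r.
Qed.

(** Grouping the sample points by [X] and the second component shows that the event [A] can be
    absorbed into an unnormalized density of [X] before the independent component is adjoined. *)
Lemma law_prodd_subdensity (W T U V : finType) (mu : W -> K) (c : U -> K)
    (X : W -> T) (A : pred W) (f : T * U -> V) (y : V) :
  law (prodd (fun x => Pr mu (fun w => (X w == x) && A w)) c) f y =
  Pr (prodd mu c) (fun wu => (f (X wu.1, wu.2) == y) && A wu.1).
Proof.
rewrite /law /Pr
  [RHS](partition_big (fun wu => (X wu.1, wu.2)) (fun xu => f xu == y)) /=;
  last by move=> ? /andP[].
apply: eq_bigr => -[x u] /= fy; rewrite /prodd /= mulr_suml.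
rewrite (reindex_onto (fun w => (w, u)) fst) /=; last first.
  by move=> [w v] /andP[_ /eqP[_ <-]].
apply: eq_bigl => w; rewrite !eqxx andbT xpair_eqE eqxx andbT andbC.
by case: eqP => [->|_]; rewrite ?fy ?andbF.
Qed.

(* Interpolating between [h] and the constant [p] reaches weight 1; when
   the denominator vanishes so does the numerator, and [h] itself works. *)
Lemma distr_completion (T : finType) (h : T -> K) (p : K) :
  (forall x, 0 <= h x <= p) -> weight h <= 1 -> 1 <= #|T|%:R * p ->
  exists P : T -> K, is_distr P /\ forall x, h x <= P x <= p.
Proof.
move=> hp h1 Tp.
set t := (1 - weight h) / (#|T|%:R * p - weight h).
have den0 : 0 <= #|T|%:R * p - weight h by lra.
have t0 : 0 <= t by apply: divr_ge0; lra.
have t1 : t <= 1.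
  have [e|ne] := eqVneq (#|T|%:R * p - weight h) 0.
    by rewrite /t e invr0 mulr0.
  by rewrite ler_pdivrMr ?lt_def ?ne ?den0 //; lra.
have hP x : h x <= h x + t * (p - h x) <= p.
  have /andP[_ hxp] := hp x.
  rewrite lerDl mulr_ge0 ?subr_ge0 //= -lerBrDl.
  by rewrite ler_piMl ?subr_ge0.
exists (fun x => h x + t * (p - h x)); split=> //; split=> [x|].
  by have /andP[+ _] := hP x; apply: le_trans; have /andP[] := hp x.
rewrite /weight big_split /= -mulr_sumr sumrB sumr_const -/(weight h).
rewrite -(mulr_natl p).
have [e|ne] := eqVneq (#|T|%:R * p - weight h) 0.
  by rewrite e mulr0; lra.
by rewrite /t divfK //; lra.
Qed.

End FiniteDistributions.

(** * Subdensities of the source for fixed side information *)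

(* [G] is the unnormalized distribution of the source and [m] the probability
   of the conditioning event. If [weight G <= m * delta] the trivial bound on
   TV suffices; otherwise [g / weight G] is bounded by [p] and can be completed
   to a distribution of sufficient min-entropy. *)
Lemma extractor_subdensity (K : realType) (n l sigma : nat) (p delta eps m : K)
    (ext : bits n * bits l -> bits sigma * bits l) (G g : bits n -> K) :
  0 < p -> 0 <= delta -> 0 <= eps -> 0 <= m -> 1 <= 2 ^+ n * p ->
  (forall P : bits n -> K, is_distr P -> (forall d, P d <= p) ->
     TV (law (prodd P (unif K (bits l))) ext) (unif K (bits sigma * bits l)%type)
       <= eps) ->
  (forall d, 0 <= g d) -> (forall d, g d <= G d) ->
  (forall d, g d <= m * (p * delta)) ->
  TV (law (prodd G (unif K (bits l))) ext)
     (fun y => weight G * unif K (bits sigma * bits l)%type y)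
    <= eps * weight G + (weight G - weight g) + m * delta.
Proof.
move=> p0 delta0 eps0 m0 np hext g0 gG gp.
have cardb k : (0 < #|{: bits k}|)%N by rewrite card_tuple expn_gt0 card_bool.
have ul : is_distr (unif K (bits l)) by apply: unif_distr; exact: cardb.
have uy : is_distr (unif K (bits sigma * bits l)%type).
  by apply: unif_distr; rewrite card_prod muln_gt0 !cardb.
have G0 d : 0 <= G d by apply: le_trans (gG d).
have wg : weight g <= weight G by apply: ler_sum.
have wG : 0 <= weight G by apply: sumr_ge0.
have md : 0 <= m * delta by exact: mulr_ge0.
have [small|large] := leP (weight G) (m * delta).
  (* Both functions have weight [weight G], so with the minorant 0 their distance is at most
     [weight G]. *)
  apply: le_trans (@TV_common_minorant K _ (fun=> 0) _ _ _ _) _.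
  - by move=> y; apply: Pr_ge0 => -[d s]; rewrite mulr_ge0 ?ul.1 //.
  - by move=> y; rewrite mulr_ge0 ?uy.1.
  rewrite weight_law weight_prodd ul.2.
  rewrite [X in _ * (_ + X)]/weight -mulr_sumr -/(weight (unif K _)) uy.2.
  rewrite [X in _ - X]/weight big1 //.
  have : 0 <= eps * weight G by exact: mulr_ge0.
  lra.
have wG0 : 0 < weight G by lra.
have [|||P [dP gP]] := @distr_completion K _ (fun d => g d / weight G) p.
- move=> d; rewrite divr_ge0 //= ler_pdivrMr //; apply: le_trans (gp d) _.
  by rewrite mulrCA ler_wpM2l // ltW.
- by rewrite /weight -mulr_suml ler_pdivrMr // mul1r.
- by rewrite card_tuple card_bool natrX.
have Pp d : P d <= p by have /andP[] := gP d.
apply: le_trans (TV_triangle (law (prodd (fun d => weight G * P d)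
  (unif K (bits l))) ext) _ _) _.
have lawE : law (prodd (fun d => weight G * P d) (unif K (bits l))) ext =
  fun y => weight G * law (prodd P (unif K (bits l))) ext y.
  apply/funext => y; rewrite /law /Pr mulr_sumr.
  by apply: eq_bigr => ds _; rewrite /prodd mulrA.
(* [g] lies below both [G] and [weight G * P], which have the same weight; exchanging them costs
   only the mass of [G] not covered by [g]. *)
have h1 : TV (law (prodd G (unif K (bits l))) ext)
  (law (prodd (fun d => weight G * P d) (unif K (bits l))) ext)
   <= weight G - weight g.
  apply: le_trans (TV_law _ _ _) _; rewrite TV_prodd //.
  apply: le_trans (TV_common_minorant gG _) _.
    by move=> d; have /andP[+ _] := gP d; rewrite ler_pdivrMr // mulrC.
  rewrite [X in _ * (_ + X)]/weight -mulr_sumr -/(weight P) dP.2.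
  lra.
rewrite lawE in h1 *; rewrite TVZ //.
apply: le_trans (lerD h1 (ler_wpM2l wG (hext P dP Pp))) _.
lra.
Qed.

(** The witness is [mut], scaled by the probability of [ze] and summed over the [r] accepted by [A].
    For these [F] is at most [B], and [q] sums to 1, whence the pointwise bound. Rejected [r] have a
    nonnegative deficit, so leaving them out does not increase the total. *)
Lemma soft_UPE_subdensity (K : realType) (RT ZT ET : finType) (n : nat)
    (D : RT -> bits n) (mu : RT * ZT * ET -> K) (A : pred (RT * ZT)) (B : K)
    (F : RT -> ZT -> K) (e : ET) (z : ZT)
    (mut : bits n * RT -> K) (q : RT -> bits n -> K) :
  let ze := fun w : RT * ZT * ET => (w.1.2 == z) && (w.2 == e) in
  (forall w, 0 <= mu w) ->
  0 <= B -> (forall r, A (r, z) -> F r z <= B) ->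
  (forall dr, 0 <= mut dr) ->
  (0 < Pr mu ze ->
    forall dr, mut dr <= cond mu (fun w => (D w.1.1, w.1.1)) ze dr) ->
  (forall r d, 0 <= q r d) -> (forall d, \sum_r q r d = 1) ->
  (forall d r, mut (d, r) <= F r z * q r d) ->
  let G := fun d => Pr mu (fun w => (D w.1.1 == d) && (ze w && A w.1)) in
  exists g : bits n -> K,
    [/\ forall d, 0 <= g d, forall d, g d <= G d,
        forall d, g d <= Pr mu ze * B
      & weight G - weight g <= Pr mu ze * (1 - weight mut)].
Proof.
move=> ze mu0 B0 FB mut0 mutle q0 q1 mutF G.
have m0 : 0 <= Pr mu ze by exact: Pr_ge0.
pose c d r := Pr mu (fun w => ((D w.1.1, w.1.1) == (d, r)) && ze w).
have cE : \sum_d \sum_r c d r = Pr mu ze.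
  rewrite pair_big -(Pr_partition mu (fun w => (D w.1.1, w.1.1)) ze) /=.
  by apply: eq_bigr => -[d r].
have mc d r : Pr mu ze * mut (d, r) <= c d r.
  have [m1|] := ltP 0 (Pr mu ze).
    by have := mutle m1 (d, r); rewrite ler_pdivlMr // mulrC.
  by move=> ?; rewrite (_ : Pr mu ze = 0) ?mul0r ?Pr_ge0 //; apply/le_anti/andP.
have GE d : G d = \sum_(r | A (r, z)) c d r.
  rewrite /G /Pr (partition_big (fun w => w.1.1) (fun r => A (r, z))) /=.
    apply: eq_bigr => r Ar; apply: eq_bigl => -[[r' z'] e'] /=.
    rewrite /ze /= xpair_eqE -!andbA.
    case: (r' =P r) => [->|]; rewrite ?andbT ?andbF //.
    by case: (z' =P z) => [->|]; rewrite ?Ar ?andbT.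
  by move=> [[r z'] e'] /=; rewrite /ze /= => /and3P[_ /andP[/eqP <-]].
exists (fun d => Pr mu ze * \sum_(r | A (r, z)) mut (d, r)); split=> [d|d|d|].
- by rewrite mulr_ge0 // sumr_ge0.
- by rewrite GE mulr_sumr ler_sum.
- rewrite ler_wpM2l // -[B]mulr1 -(q1 d) mulr_sumr [leLHS]big_mkcond /=.
  apply: ler_sum => r _; case: ifP => [Ar|_]; last by rewrite mulr_ge0.
  by apply: le_trans (mutF d r) _; rewrite ler_wpM2r ?FB.
- have -> : Pr mu ze * (1 - weight mut) =
      \sum_d \sum_r (c d r - Pr mu ze * mut (d, r)).
    rewrite mulrBr mulr1 -{1}cE /weight mulr_sumr.
    rewrite pair_big [RHS]pair_big -sumrB /=.
    by apply: eq_bigr => -[].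
  rewrite /weight -sumrB; apply: ler_sum => d _.
  rewrite GE mulr_sumr -sumrB [leLHS]big_mkcond /=.
  by apply: ler_sum => r _; case: ifP => // _; rewrite subr_ge0.
Qed.

Lemma powR_log2 (K : realType) (p : K) : 0 < p -> 2 `^ log2 p = p.
Proof.
move=> p0; rewrite /powR /log2 pnatr_eq0 /= divfK ?lnK ?posrE //.
by rewrite gt_eqF // ln_gt0 // ltr1n.
Qed.

(** * Near-uniformity given the side information, and soundness *)

Theorem theorem19 (K : realType) (RT ZT ET : finType) (n : nat)
    (D : RT -> bits n)
    (H : set (RT * ZT * ET -> K)) (hH : forall mu, H mu -> is_distr mu)
    (eps_h : K) (F : RT -> ZT -> K) (hF : soft_UPE D H eps_h F)
    (p delta : K) (hp : 0 < p) (hdelta : 0 < delta)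
    (hpdelta : 1 / 2 ^+ n <= p * delta)
    (sigma_h : K) (hsigma_h : sigma_h = - log2 p)
    (Ext : extractor_family K) (adm : extractor_constraints K)
    (hExt : strong_extractor Ext adm)
    (l sigma : nat) (eps_x : K) (hadm : adm n l sigma_h sigma eps_x) :
  let W := (RT * ZT * ET * bits l)%type in
  let rvS := fun w : W => w.2 in
  let rvExt := fun w : W => Ext n l sigma_h sigma eps_x (D w.1.1.1) w.2 in
  let rvZE := fun w : W => (w.1.1.2, w.1.2) in
  let success := fun w : W => F w.1.1.1 w.1.1.2 <= p * delta in
  (forall mu, H mu ->
    let mu' := seeded (l := l) mu in
    let kappa := Pr mu' success in
    0 < kappa ->
    TV (cond mu' (fun w => (rvExt w, rvS w, rvZE w)) success)
       (prodd (unif K (bits sigma * bits l)%type) (cond mu' rvZE success))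
      <= eps_x + (2 * eps_h + delta) / kappa)
  /\ sound rvExt rvS success rvZE (seeded_model (l := l) H)
       sigma (eps_x + 2 * eps_h + delta).
Proof.
move=> W rvS rvExt rvZE success.
have [sigma_n _ _ /andP[eps_x0 _] extP] := hExt _ _ _ _ _ hadm.
have [/andP[eps_h0 _] _ hUPE] := hF.
have pE : 2 `^ (- sigma_h) = p by rewrite hsigma_h opprK powR_log2.
(* The constraint [sigma_h <= n] leaves room on the [n]-bit strings for a distribution bounded by
   [p]. *)
have np : 1 <= 2 ^+ n * p.
  rewrite mulrC -ler_pdivrMr ?exprn_gt0 // mul1r -pE -powR_mulrn //.
  by rewrite -powRN ler_powR ?lerN2 // ler1n.
have cardb k : (0 < #|{: bits k}|)%N by rewrite card_tuple expn_gt0 card_bool.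
have ul : is_distr (unif K (bits l)) by apply: unif_distr; exact: cardb.
pose ext ds := (Ext n l sigma_h sigma eps_x ds.1 ds.2, ds.2 : bits l).
pose u := unif K (bits sigma * bits l)%type.
(* The default value 0 of the maximum is harmless because [p] is positive. *)
have hext (P : bits n -> K) : is_distr P -> (forall d, P d <= p) ->
    TV (law (prodd P (unif K (bits l))) ext) u <= eps_x.
  move=> dP Pp; apply: extP => //; rewrite pE.
  by apply: bigmax_le => //; exact: ltW.
have pd0 : 0 <= p * delta by rewrite mulr_ge0 ?ltW.
(* The bound is first shown multiplied by the success probability: unnormalized densities add up
   over the side information without division. *)
have main mu (mu' := seeded (l := l) mu) : H mu ->
  TV (fun y => Pr mu' (fun w => ((rvExt w, rvS w, rvZE w) == y) && success w))
     (prodd u (fun ze => Pr mu' (fun w => (rvZE w == ze) && success w)))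
  <= eps_x * Pr mu' success + eps_h + delta.
  move=> Hmu; have [mu0 mu1] := hH mu Hmu.
  pose A rz := F rz.1 rz.2 <= p * delta.
  (* [G e z] is the part of the density of [D] on which the side information is [(z, e)] and the
     protocol succeeds. *)
  pose acc e z (w : RT * ZT * ET) := ((w.1.2 == z) && (w.2 == e)) && A w.1.
  pose G e z d := Pr mu (fun w => (D w.1.1 == d) && acc e z w).
  have wG e z : weight (G e z) = Pr mu (acc e z) by exact: Pr_partition.
  have jointE y z e :
      Pr mu' (fun w => ((rvExt w, rvS w, rvZE w) == (y, (z, e))) && success w) =
      law (prodd (G e z) (unif K (bits l))) ext y.
    rewrite law_prodd_subdensity; apply: eq_bigl => -[[[r z'] e'] s] /=.
    by rewrite xpair_eqE -!andbA /acc [X in _ && X]andbA.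
  have sideE z e :
      Pr mu' (fun w => (rvZE w == (z, e)) && success w) = weight (G e z).
    rewrite wG -(Pr_prodd_fst mu (acc e z) ul.2).
    apply: eq_bigl => -[[[r z1] e1] s].
    by rewrite /rvZE xpair_eqE.
  have kappaE : Pr mu' success = \sum_e \sum_z weight (G e z).
    rewrite -(Pr_partition mu' rvZE) exchange_big pair_big /=.
    by apply: eq_bigr => -[z e] _; rewrite sideE.
  have slice e : \sum_z TV (law (prodd (G e z) (unif K (bits l))) ext)
                           (fun y => weight (G e z) * u y)
      <= eps_x * \sum_z weight (G e z)
         + Pr mu (fun w => w.2 == e) * (eps_h + delta).
    pose ze z (w : RT * ZT * ET) := (w.1.2 == z) && (w.2 == e).
    have eE : \sum_z Pr mu (ze z) = Pr mu (fun w => w.2 == e).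
      exact: Pr_partition.
    have ze0 z : 0 <= Pr mu (ze z) by exact: Pr_ge0.
    (* For [e] of probability 0 the soft UPE property says nothing; there every [G e z] vanishes,
       and the subdensity bound is used with [m = 0] and [g = 0]. *)
    have [e0|e_le0] := ltP 0 (Pr mu (fun w => w.2 == e)); last first.
      have e0 : Pr mu (fun w => w.2 == e) = 0.
        by apply/le_anti; rewrite e_le0 Pr_ge0.
      rewrite e0 mul0r addr0 mulr_sumr; apply: ler_sum => z _.
      have zz : Pr mu (ze z) = 0.
        apply/le_anti; rewrite ze0 andbT -e0.
        by apply: Pr_sub => // w /andP[].
      have G0 d : G e z d = 0.
        apply/le_anti; rewrite Pr_ge0 // andbT -zz.
        by apply: Pr_sub => // w /andP[_ /andP[]].
      have wG0 : weight (G e z) = 0 by exact: big1.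
      apply: le_trans (@extractor_subdensity K n l sigma p delta eps_x 0 ext
        (G e z) (fun=> 0) hp (ltW hdelta) (ltW eps_x0) (lexx _) np hext _ _ _) _.
      + by [].
      + by move=> d; rewrite G0.
      + by move=> d; rewrite mul0r.
      + by rewrite wG0 [X in _ - X]/weight big1 // subrr mul0r !addr0.
    have [mut [mut_sub mut_le mut_w [q [q0 q1 mutF]]]] := hUPE e mu Hmu e0.
    have step z : TV (law (prodd (G e z) (unif K (bits l))) ext)
        (fun y => weight (G e z) * u y)
        <= eps_x * weight (G e z) + Pr mu (ze z) * (1 - weight (mut z))
           + Pr mu (ze z) * delta.
      have [] := @soft_UPE_subdensity K RT ZT ET n D mu A (p * delta) F e z
        (mut z) (fun r d => q r d z) mu0 pd0 _ (mut_sub z).1 (mut_le z) _ _ _ => //.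
      move=> g [g0 gG gB gw].
      apply: le_trans (@extractor_subdensity K n l sigma p delta eps_x
        (Pr mu (ze z)) ext (G e z) g hp (ltW hdelta) (ltW eps_x0) (ze0 z) np
        hext g0 gG gB) _.
      by rewrite lerD2r lerD2l.
    apply: le_trans (ler_sum _ (fun z _ => step z)) _.
    rewrite !big_split /= -mulr_sumr -mulr_suml eE mulrDr addrA lerD2r lerD2l.
    (* The smoothing deficits, averaged over [z] given [e], become one minus the total weight in the
       soft UPE condition, hence at most [eps_h]. *)
    have -> : \sum_z Pr mu (ze z) * (1 - weight (mut z)) =
        Pr mu (fun w => w.2 == e) *
        (1 - \sum_z weight (mut z) *
           cond mu (fun w => w.1.2) (fun w => w.2 == e) z).
      rewrite mulrBr mulr1 -{1}eE mulr_sumr -sumrB; apply: eq_bigr => z _.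
      by rewrite /cond mulrBr mulr1 mulrCA mulrC [_ * (_ / _)]mulrC divfK ?gt_eqF.
    by rewrite ler_wpM2l ?(ltW e0) // lerBlDr -lerBlDl.
  rewrite TV_slices -(pair_big predT predT (fun z e => TV
    (fun y => Pr mu' (fun w =>
       ((rvExt w, rvS w, rvZE w) == (y, (z, e))) && success w))
    (fun y => u y * Pr mu' (fun w => (rvZE w == (z, e)) && success w)))) /=.
  rewrite exchange_big /=.
  apply: le_trans (_ : \sum_e (eps_x * \sum_z weight (G e z)
         + Pr mu (fun w => w.2 == e) * (eps_h + delta)) <= _).
    apply: ler_sum => e _; apply: le_trans (slice e); apply: ler_sum => z _.
    rewrite (_ : (fun y => Pr mu' _) = law (prodd (G e z) (unif K (bits l))) ext);
      last by apply/funext => y; rewrite jointE.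
    rewrite (_ : (fun y => u y * _) = fun y => weight (G e z) * u y) //.
    by apply/funext => y; rewrite sideE mulrC.
  rewrite big_split /= -mulr_sumr -mulr_suml -kappaE.
  have -> : \sum_e Pr mu (fun w => w.2 == e) = 1.
    by rewrite -mu1 -(weight_law mu snd).
  by rewrite mul1r addrA.
(* Homogeneity of the distance moves the factor [kappa] inside, where it cancels the normalization
   of both conditional distributions. *)
have normalized mu (mu' := seeded (l := l) mu) (kappa := Pr mu' success) :
  H mu -> 0 < kappa ->
  TV (cond mu' (fun w => (rvExt w, rvS w, rvZE w)) success)
     (prodd u (cond mu' rvZE success)) * kappa
  <= eps_x * kappa + eps_h + delta.
  move=> Hmu kappa0; apply: le_trans (main mu Hmu).
  rewrite mulrC -TVZ ?(ltW kappa0) //.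
  rewrite (_ : (fun y => kappa * cond _ _ _ y) = fun y =>
    Pr mu' (fun w => ((rvExt w, rvS w, rvZE w) == y) && success w)); last first.
    by apply/funext => y; rewrite /cond mulrC divfK ?gt_eqF.
  rewrite (_ : (fun y => kappa * prodd _ _ y) = prodd u (fun ze =>
    Pr mu' (fun w => (rvZE w == ze) && success w))) //.
  apply/funext => -[y ze].
  by rewrite /prodd /cond mulrCA [kappa * _]mulrC divfK ?gt_eqF.
split=> [mu Hmu mu' kappa kappa0|_ [mu Hmu <-]].
  have /= := normalized mu Hmu kappa0.
  rewrite -ler_pdivlMr // => /le_trans; apply.
  rewrite -/mu' -/kappa -addrA mulrDl mulfK ?gt_eqF // lerD2l.
  by rewrite ler_pM2r ?invr_gt0 //; lra.
split=> //; have dmu' : is_distr (seeded (l := l) mu).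
  have [mu0 mu1] := hH mu Hmu; split=> [w|].
    by rewrite /seeded /prodd mulr_ge0 ?ul.1.
  by rewrite weight_prodd mu1 ul.2 mulr1.
have [kappa0|] := ltP 0 (Pr (seeded (l := l) mu) success); last first.
  (* With success probability 0 the product is 0, so any distribution of the side information will
     do. *)
  move=> kappa_le0; exists (law (seeded (l := l) mu) rvZE).
    exact: law_distr.
  rewrite (_ : Pr _ success = 0) ?mulr0; first lra.
  by apply/le_anti; rewrite kappa_le0 Pr_ge0 //; exact: dmu'.1.
exists (cond (seeded (l := l) mu) rvZE success).
  by apply: cond_distr => //; exact: dmu'.1.
(* The seed keeps its uniform law by independence, so the ideal output is uniform on pairs. *)
have -> : prodd (unif K (bits sigma)) (law (seeded (l := l) mu) rvS) = u.
  apply/funext => -[x s]; rewrite /prodd /law /=.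
  rewrite (@Pr_prodd_snd _ _ _ _ _ (fun t => t == s)) ?(hH mu Hmu).2 //.
  by rewrite /Pr big_pred1_eq /u /unif card_prod natrM invfM.
apply: le_trans (normalized mu Hmu kappa0) _.
(* Bounds [eps_x * kappa] by [eps_x]. *)
have kappa1 : Pr (seeded (l := l) mu) success <= 1.
  rewrite -dmu'.2; apply: Pr_sub (fun=> true) _ _ => //; exact: dmu'.1.
have := ler_wpM2l (ltW eps_x0) kappa1.
lra.
Qed.
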